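(* Let $0<q<1$. (a) The function $\big(\Gamma_q(x)\big)^{\frac{1}{x}}$ is strictly log-convex on $(0,1]$. (b) The function $\big(\Gamma_q(x)\big)^{x}$ is strictly log-convex on $[1,\infty)$.
   Context: For $0<q<1$ and complex $a$, $(a;q)_\infty=\prod_{i=0}^{\infty}(1-aq^i)$. For real $x>0$, the $q$-gamma function is $\Gamma_q(x)=\frac{(q;q)_\infty}{(q^x;q)_\infty}(1-q)^{1-x}$. A positive function is strictly log-convex if its logarithm is strictly convex. *)

(* Defs.v *)
From Stdlib Require Import Reals.
From Coquelicot Require Import Coquelicot.
Open Scope R_scope.

(** [(a; q)_oo] for real [a].  [prod_f_R0 f n] is the product of
    [f 0, ..., f n] ([n + 1] factors).  [Lim_seq] is total with values in
    [Rbar]; for [0 < q < 1] the partial products do converge to a finite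
    limit. *)
Definition qpochhammer_inf (a q : R) : R :=
  real (Lim_seq (fun n => prod_f_R0 (fun i => 1 - a * q ^ i) n)).

(** Meant for [0 < q < 1] and [0 < x], where the bases of all the real powers
    are positive. *)
Definition Gamma_q (q x : R) : R :=
  qpochhammer_inf q q / qpochhammer_inf (Rpower q x) q * Rpower (1 - q) (1 - x).

(** To be used with [I] an interval. *)
Definition strictly_convex_on (I : R -> Prop) (f : R -> R) : Prop :=
  forall x y t : R, I x -> I y -> x <> y -> 0 < t < 1 ->
    f (t * x + (1 - t) * y) < t * f x + (1 - t) * f y.

Definition strictly_log_convex_on (I : R -> Prop) (f : R -> R) : Prop :=
  (forall x : R, I x -> 0 < f x) /\ strictly_convex_on I (fun x => ln (f x)).

(* Main.v *)
Require Import Defs.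
From Stdlib Require Import Reals.
From Coquelicot Require Import Coquelicot.
From Stdlib Require Import Lra Lia.
Open Scope R_scope.

(** The logarithm of [Gamma_q] is a series of elementary functions each of
    which already has the required convexity, so no estimate on the sum is
    needed.

    Expanding [-ln (1 - b) = sum_{m >= 1} b^m / m] in every factor of the
    [q]-Pochhammer symbols gives [(a;q)_oo = exp (- Lambda a)] with
    [Lambda a = sum_{m >= 1} a^m / (m (1 - q^m))] (lemma
    [qpochhammer_inf_exp]).  Expanding also the power of [1 - q] yields
    [ln (Gamma_q x) = sum_{m >= 1} psi (m u) x / m], where [u = - ln q] and
    [psi v x = (e^(-v x) - e^(-v)) / (1 - e^(-v)) - (1 - x) e^(-v)]
    (lemma [is_series_ln_Gamma_q]).

    For every [v > 0], [psi v x / x] has positive second derivative on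
    [(0, 1]] and [x * psi v x] has positive second derivative on [[1, oo)];
    both reduce to [1 + v + v^2 / 2 <= e^v].  A convergent series of strictly
    convex functions is strictly convex, which gives both claims. *)

(** * Strict convexity *)

Definition is_interval (I : R -> Prop) : Prop :=
  forall x y z : R, I x -> I y -> x <= z <= y -> I z.

Lemma is_interval_segment (I : R -> Prop) (x y t : R) :
  is_interval I -> I x -> I y -> 0 < t < 1 -> I (t * x + (1 - t) * y).
Proof.
intros hI Ix Iy ht.
destruct (Rle_dec x y) as [h | h].
- apply (hI x y); trivial; nra.
- apply (hI y x); trivial; nra.
Qed.

Lemma strictly_convex_on_scal (I : R -> Prop) (f : R -> R) (c : R) :
  0 < c -> strictly_convex_on I f -> strictly_convex_on I (fun x => c * f x).
Proof.
intros hc hf x y t Ix Iy hxy ht.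
specialize (hf x y t Ix Iy hxy ht).
apply (Rmult_lt_compat_l c) in hf; lra.
Qed.

(** The two chords that meet at an intermediate point have slopes [f' c1] and
    [f' c2] with [c1 < c2], by the mean value theorem, and [f'] increases. *)
Lemma strictly_convex_on_derive2 (I : R -> Prop) (f f' f'' : R -> R) :
  is_interval I ->
  (forall x, I x -> is_derive f x (f' x)) ->
  (forall x, I x -> is_derive f' x (f'' x)) ->
  (forall x, I x -> 0 < f'' x) ->
  strictly_convex_on I f.
Proof.
intros hI hf hf' hpos.
assert (main : forall x y t, I x -> I y -> x < y -> 0 < t < 1 ->
  f (t * x + (1 - t) * y) < t * f x + (1 - t) * f y).
{ intros x y t Ix Iy hxy ht.
  set (z := t * x + (1 - t) * y).
  assert (hz : x < z < y) by (unfold z; nra).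
  destruct (MVT_cor2 f f' x z) as [c1 [e1 h1]]; [lra | |].
  { intros c hc; apply is_derive_Reals, hf, (hI x y); trivial; lra. }
  destruct (MVT_cor2 f f' z y) as [c2 [e2 h2]]; [lra | |].
  { intros c hc; apply is_derive_Reals, hf, (hI x y); trivial; lra. }
  destruct (MVT_cor2 f' f'' c1 c2) as [c3 [e3 h3]]; [lra | |].
  { intros c hc; apply is_derive_Reals, hf', (hI x y); trivial; lra. }
  assert (h4 : 0 < f'' c3) by (apply hpos, (hI x y); trivial; lra).
  assert (h5 : 0 < f' c2 - f' c1) by (rewrite e3; apply Rmult_lt_0_compat; lra).
  assert (h6 : 0 < t * (1 - t) * (y - x) * (f' c2 - f' c1)).
  { repeat apply Rmult_lt_0_compat; lra. }
  replace (z - x) with ((1 - t) * (y - x)) in e1 by (unfold z; ring).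
  replace (y - z) with (t * (y - x)) in e2 by (unfold z; ring).
  replace (f x) with (f z - f' c1 * ((1 - t) * (y - x))) by lra.
  replace (f y) with (f z + f' c2 * (t * (y - x))) by lra.
  lra. }
intros x y t Ix Iy hxy ht.
destruct (Rtotal_order x y) as [h | [h | h]]; [auto | lra |].
specialize (main y x (1 - t) Iy Ix h).
replace (t * x + (1 - t) * y) with ((1 - t) * y + (1 - (1 - t)) * x) by ring.
lra.
Qed.

(** Over [R] itself, so that the termwise goal is an equation in the carrier
    on which [ring] and [field] work. *)
Lemma is_series_ext_R (a b : nat -> R) (l : R) :
  (forall n, a n = b n) -> is_series a l -> is_series b l.
Proof. exact (is_series_ext a b l). Qed.

(** A positive series dominates its first term, so its sum cannot vanish. *)
Lemma is_series_pos (a : nat -> R) (l : R) :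
  (forall k, 0 < a k) -> is_series a l -> 0 < l.
Proof.
intros ha hl.
assert (hle : Rbar_le (a 0%nat) l).
{ apply (is_lim_seq_le (fun _ => a 0%nat) (sum_n a)).
  - induction n as [| n IHn].
    + rewrite sum_O; lra.
    + rewrite sum_Sn; unfold plus; simpl; specialize (ha (S n)); lra.
  - apply is_lim_seq_const.
  - exact hl. }
simpl in hle; specialize (ha 0%nat); lra.
Qed.

Lemma strictly_convex_on_series (I : R -> Prop) (u : nat -> R -> R) (f : R -> R) :
  is_interval I ->
  (forall x, I x -> is_series (fun k => u k x) (f x)) ->
  (forall k, strictly_convex_on I (u k)) ->
  strictly_convex_on I f.
Proof.
intros hI hs hu x y t Ix Iy hxy ht.
apply Rminus_lt_0.
apply (is_series_pos
  (fun k => t * u k x + (1 - t) * u k y - u k (t * x + (1 - t) * y))).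
- intros k; apply Rlt_0_minus, hu; trivial.
- apply (is_series_minus (V := R_NormedModule)
    (fun k => t * u k x + (1 - t) * u k y)
    (fun k => u k (t * x + (1 - t) * y))).
  + apply (is_series_plus (V := R_NormedModule)
      (fun k => t * u k x) (fun k => (1 - t) * u k y)).
    * apply (is_series_scal_l (V := R_NormedModule) t (fun k => u k x)); auto.
    * apply (is_series_scal_l (V := R_NormedModule) (1 - t) (fun k => u k y)); auto.
  + apply hs, is_interval_segment; trivial.
Qed.

(** * The logarithmic series *)

Lemma is_derive_log_partial_sum (n : nat) (x : R) :
  x < 1 ->
  is_derive (fun y => sum_n (fun k => y ^ S k / INR (S k)) n + ln (1 - y)) x
    (- x ^ S n / (1 - x)).
Proof.
intros hx; induction n as [| n IHn].
- apply (is_derive_ext (fun y => y + ln (1 - y))).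
  + intros y; rewrite sum_O; simpl; field.
  + auto_derive; [lra |]; simpl; field; lra.
- apply (is_derive_ext
    (fun y => (sum_n (fun k => y ^ S k / INR (S k)) n + ln (1 - y))
              + y ^ S (S n) / INR (S (S n)))).
  + intros y; rewrite sum_Sn; unfold plus; cbn -[pow INR sum_n]; ring.
  + replace (- x ^ S (S n) / (1 - x))
      with (- x ^ S n / (1 - x)
            + / INR (S (S n)) * (INR (S (S n)) * 1 * x ^ S n)).
    * apply (is_derive_plus (V := R_NormedModule)); [exact IHn |].
      apply (is_derive_ext (fun y => / INR (S (S n)) * y ^ S (S n))).
      { intros y; apply Rmult_comm. }
      apply is_derive_scal.
      apply (is_derive_pow (fun y => y) (S (S n)) x 1).
      apply (is_derive_id (K := R_AbsRing)).
    * assert (INR (S (S n)) <> 0) by (apply not_0_INR; lia).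
      simpl pow; field; split; (assumption || lra).
Qed.

(** By the mean value theorem the [n]-th remainder is at most
    [a ^ (n + 1) / (1 - a)], because its derivative is the remainder of the
    geometric series. *)
Lemma is_series_ln (a : R) :
  0 < a < 1 -> is_series (fun k => a ^ S k / INR (S k)) (- ln (1 - a)).
Proof.
intros [ha ha1].
set (S_ := sum_n (fun k => a ^ S k / INR (S k))).
assert (hrem : is_lim_seq (fun n => S_ n + ln (1 - a)) 0).
{ apply is_lim_seq_abs_0.
  apply (is_lim_seq_le_le (fun _ => 0) _ (fun n => a ^ n * (a / (1 - a)))).
  - intros n; split; [apply Rabs_pos |].
    destruct (MVT_cor2
      (fun y => sum_n (fun k => y ^ S k / INR (S k)) n + ln (1 - y))
      (fun y => - y ^ S n / (1 - y)) 0 a ha) as [c [hc hc']].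
    { intros c hc; apply is_derive_Reals, is_derive_log_partial_sum; lra. }
    assert (h0 : sum_n (fun k => 0 ^ S k / INR (S k)) n + ln (1 - 0) = 0).
    { rewrite Rminus_0_r, ln_1, Rplus_0_r.
      clear; induction n as [| n IHn].
      - rewrite sum_O; simpl; field.
      - rewrite sum_Sn, IHn, pow_ne_zero by lia.
        unfold plus; simpl; unfold Rdiv; ring. }
    rewrite h0, !Rminus_0_r in hc; unfold S_; rewrite hc.
    replace (- c ^ S n / (1 - c) * a) with (- (c ^ S n / (1 - c) * a))
      by (unfold Rdiv; ring).
    assert (hcn : 0 <= c ^ S n <= a ^ S n).
    { split; [apply pow_le; lra | apply pow_incr; lra]. }
    assert (hinv : 0 < / (1 - c) <= / (1 - a)).
    { split; [apply Rinv_0_lt_compat | apply Rinv_le_contravar]; lra. }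
    assert (hp : 0 <= c ^ S n / (1 - c) * a).
    { apply Rmult_le_pos; [apply Rmult_le_pos |]; lra. }
    rewrite Rabs_Ropp, Rabs_pos_eq by assumption.
    apply Rle_trans with (a ^ S n / (1 - a) * 1).
    + apply Rmult_le_compat; try lra.
      * apply Rmult_le_pos; lra.
      * apply Rmult_le_compat; lra.
    + simpl pow; unfold Rdiv; lra.
  - apply is_lim_seq_const.
  - replace (Finite 0) with (Finite (0 * (a / (1 - a)))) by (f_equal; ring).
    apply (is_lim_seq_scal_r _ (a / (1 - a)) 0), is_lim_seq_geom.
    rewrite Rabs_pos_eq; lra. }
assert (h : is_lim_seq (fun n => (S_ n + ln (1 - a)) + - ln (1 - a)) (0 + - ln (1 - a))).
{ apply is_lim_seq_plus'; [exact hrem | apply is_lim_seq_const]. }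
rewrite Rplus_0_l in h.
apply (is_lim_seq_ext _ S_) in h; [exact h | intros n; ring].
Qed.

(** * The infinite product as the exponential of a Lambert series *)

Definition lambert_term (q a : R) (k : nat) : R :=
  a ^ S k / (INR (S k) * (1 - q ^ S k)).

Definition lambert (q a : R) : R := Series (lambert_term q a).

Lemma pow_S_lt_1 (q : R) (hq : 0 < q < 1) (k : nat) : 0 < q ^ S k <= q.
Proof.
split; [apply pow_lt; lra |].
assert (h : q ^ k <= 1).
{ rewrite <- (pow1 k); apply pow_incr; lra. }
simpl; nra.
Qed.

Lemma lambert_den_pos (q : R) (hq : 0 < q < 1) (k : nat) : 0 < INR (S k) * (1 - q ^ S k).
Proof.
apply Rmult_lt_0_compat; [apply lt_0_INR; lia |].
generalize (pow_S_lt_1 q hq k); lra.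
Qed.

Lemma is_series_lambert (q : R) (hq : 0 < q < 1) (a : R) :
  0 < a < 1 -> is_series (lambert_term q a) (lambert q a).
Proof.
intros ha; apply Series_correct.
apply (ex_series_le (V := R_CompleteNormedModule) _
  (fun k => a ^ S k / INR (S k) * / (1 - q))).
- intros k.
  assert (hk : 0 < INR (S k)) by (apply lt_0_INR; lia).
  generalize (pow_S_lt_1 q hq k) (pow_lt a (S k) (proj1 ha)); intros h1 h2.
  change (Rabs (lambert_term q a k) <= a ^ S k / INR (S k) * / (1 - q)).
  unfold lambert_term.
  rewrite Rabs_pos_eq.
  + unfold Rdiv; rewrite Rinv_mult, <- Rmult_assoc.
    apply Rmult_le_compat_l.
    * apply Rmult_le_pos; [lra |]; apply Rlt_le, Rinv_0_lt_compat, hk.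
    * apply Rinv_le_contravar; lra.
  + apply Rmult_le_pos; [lra |].
    apply Rlt_le, Rinv_0_lt_compat, (lambert_den_pos q hq).
- exists (- ln (1 - a) * / (1 - q)).
  apply is_series_scal_r, is_series_ln, ha.
Qed.

(** The factor [1 - q^m] coming from the difference cancels the denominator of
    the [m]-th term and leaves the logarithmic series. *)
Lemma lambert_shift (q : R) (hq : 0 < q < 1) (a : R) :
  0 < a < 1 -> lambert q (a * q) = lambert q a + ln (1 - a).
Proof.
intros ha.
assert (haq : 0 < a * q < 1) by nra.
assert (h : is_series (fun k => a ^ S k / INR (S k)) (lambert q a - lambert q (a * q))).
{ apply (is_series_ext_R (fun k => lambert_term q a k - lambert_term q (a * q) k)).
  - intros k; unfold lambert_term; rewrite Rpow_mult_distr.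
    generalize (pow_S_lt_1 q hq k); intros h1.
    assert (INR (S k) <> 0) by (apply not_0_INR; lia).
    field; split; (assumption || lra).
  - apply (is_series_minus (V := R_NormedModule) (lambert_term q a));
      apply (is_series_lambert q hq); assumption. }
apply is_series_unique in h.
generalize (is_series_unique _ _ (is_series_ln a ha)); lra.
Qed.

(** Each term scales by [c^m <= c]. *)
Lemma lambert_scal_bound (q : R) (hq : 0 < q < 1) (a c : R) :
  0 < a < 1 -> 0 < c <= 1 -> 0 <= lambert q (a * c) <= c * lambert q a.
Proof.
intros ha hc.
assert (hac : 0 < a * c < 1) by nra.
assert (hpos : forall b, 0 <= b -> forall k, 0 <= lambert_term q b k).
{ intros b hb k; apply Rmult_le_pos; [apply pow_le, hb |].
  apply Rlt_le, Rinv_0_lt_compat, (lambert_den_pos q hq). }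
split.
- apply (Rle_trans _ (Series (fun _ => 0 * 0))).
  { rewrite Series_scal_l; lra. }
  apply Series_le.
  + intros k; rewrite Rmult_0_l; split; [lra | apply hpos; lra].
  + exists (lambert q (a * c)); apply (is_series_lambert q hq), hac.
- unfold lambert; rewrite <- Series_scal_l; apply Series_le.
  + intros k; split; [apply hpos; lra |].
    replace (lambert_term q (a * c) k) with (c ^ S k * lambert_term q a k).
    * apply Rmult_le_compat_r; [apply hpos; lra |].
      assert (h : c ^ k <= 1) by (rewrite <- (pow1 k); apply pow_incr; lra).
      simpl; nra.
    * unfold lambert_term; rewrite Rpow_mult_distr; unfold Rdiv; ring.
  + exists (c * lambert q a).
    apply (is_series_scal_l (V := R_NormedModule) c (lambert_term q a)).
    apply (is_series_lambert q hq), ha.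
Qed.

Lemma qpochhammer_partial (q : R) (hq : 0 < q < 1) (a : R) (n : nat) :
  0 < a < 1 ->
  prod_f_R0 (fun i => 1 - a * q ^ i) n
  = exp (lambert q (a * q ^ S n) - lambert q a).
Proof.
intros ha; induction n as [| n IHn].
- simpl prod_f_R0; rewrite pow_1, (lambert_shift q hq) by assumption.
  replace (lambert q a + ln (1 - a) - lambert q a) with (ln (1 - a)) by ring.
  rewrite exp_ln; simpl; lra.
- assert (hb : 0 < a * q ^ S n < 1).
  { generalize (pow_S_lt_1 q hq n); nra. }
  change (prod_f_R0 (fun i => 1 - a * q ^ i) (S n))
    with (prod_f_R0 (fun i => 1 - a * q ^ i) n * (1 - a * q ^ S n)).
  rewrite IHn.
  replace (a * q ^ S (S n)) with (a * q ^ S n * q) by (simpl; ring).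
  rewrite (lambert_shift q hq (a * q ^ S n)) by assumption.
  replace (lambert q (a * q ^ S n) + ln (1 - a * q ^ S n) - lambert q a)
    with ((lambert q (a * q ^ S n) - lambert q a) + ln (1 - a * q ^ S n)) by ring.
  rewrite exp_plus, (exp_ln (1 - a * q ^ S n)); lra.
Qed.

(** The partial products telescope, and the remaining [lambert q (a q^n)] is
    at most [q^n * lambert q a]. *)
Lemma qpochhammer_inf_exp (q : R) (hq : 0 < q < 1) (a : R) :
  0 < a < 1 -> qpochhammer_inf a q = exp (- lambert q a).
Proof.
intros ha; unfold qpochhammer_inf.
assert (hrem : is_lim_seq (fun n => lambert q (a * q ^ S n)) 0).
{ apply (is_lim_seq_le_le (fun _ => 0) _ (fun n => q ^ S n * lambert q a)).
  - intros n; apply (lambert_scal_bound q hq); trivial.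
    generalize (pow_S_lt_1 q hq n); lra.
  - apply is_lim_seq_const.
  - replace (Finite 0) with (Finite (0 * lambert q a)) by (f_equal; ring).
    apply (is_lim_seq_scal_r _ (lambert q a) 0).
    apply (is_lim_seq_incr_1 (fun n => q ^ n)), is_lim_seq_geom.
    rewrite Rabs_pos_eq; lra. }
rewrite (is_lim_seq_unique _ (exp (- lambert q a))); [reflexivity |].
apply (is_lim_seq_ext (fun n => exp (lambert q (a * q ^ S n) - lambert q a))).
{ intros n; symmetry; apply (qpochhammer_partial q hq), ha. }
apply (is_lim_seq_continuous exp).
- apply derivable_continuous_pt, derivable_pt_exp.
- replace (- lambert q a) with (0 - lambert q a) by ring.
  apply is_lim_seq_minus'; [exact hrem | apply is_lim_seq_const].
Qed.

(** * The series for the logarithm of the q-gamma function *)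

Definition psi (v x : R) : R :=
  (exp (- (v * x)) - exp (- v)) / (1 - exp (- v)) - (1 - x) * exp (- v).

Lemma Rpower_base_lt_1 (q x : R) : 0 < q < 1 -> 0 < x -> 0 < Rpower q x < 1.
Proof.
intros hq hx; split; [apply exp_pos |].
unfold Rpower; rewrite <- exp_0; apply exp_increasing.
assert (ln q < 0) by (rewrite <- ln_1; apply ln_increasing; lra).
nra.
Qed.

(** With [u = - ln q], the [m]-th terms of the three series that make up
    [ln (Gamma_q q x)] add up to [psi (m u) x / m]. *)
Lemma is_series_ln_Gamma_q (q x : R) :
  0 < q < 1 -> 0 < x ->
  is_series (fun k => / INR (S k) * psi (INR (S k) * - ln q) x) (ln (Gamma_q q x)).
Proof.
intros hq hx.
assert (hp := Rpower_base_lt_1 q x hq hx).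
unfold Gamma_q.
rewrite !(qpochhammer_inf_exp q hq) by lra.
unfold Rpower at 2, Rdiv at 1; rewrite <- exp_Ropp, <- !exp_plus, ln_exp.
replace (- lambert q q + - - lambert q (Rpower q x) + (1 - x) * ln (1 - q))
  with (lambert q (Rpower q x) - lambert q q - (1 - x) * - ln (1 - q)) by ring.
apply (is_series_ext_R (fun k =>
  lambert_term q (Rpower q x) k - lambert_term q q k
  - (1 - x) * (q ^ S k / INR (S k)))).
- intros k; unfold psi, lambert_term.
  replace (exp (- (INR (S k) * - ln q))) with (q ^ S k).
  2: { rewrite <- Rpower_pow by lra; unfold Rpower; f_equal; ring. }
  replace (exp (- (INR (S k) * - ln q * x))) with (Rpower q x ^ S k).
  2: { rewrite <- Rpower_pow by lra; unfold Rpower; rewrite ln_exp; f_equal; ring. }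
  generalize (pow_S_lt_1 q hq k); intros h1.
  assert (INR (S k) <> 0) by (apply not_0_INR; lia).
  field; split; (assumption || lra).
- apply (is_series_minus (V := R_NormedModule)
    (fun k => lambert_term q (Rpower q x) k - lambert_term q q k)).
  + apply (is_series_minus (V := R_NormedModule) (lambert_term q (Rpower q x)));
      apply (is_series_lambert q hq); lra.
  + apply (is_series_scal_l (V := R_NormedModule) (1 - x)
      (fun k => q ^ S k / INR (S k))).
    apply is_series_ln; lra.
Qed.

(** * Convexity of the terms *)

Lemma exp_ge_quadratic (v : R) : 0 <= v -> 1 + v + v ^ 2 / 2 <= exp v.
Proof.
intros hv; apply Rle_trans with (2 := exp_ge_taylor v 2 hv).
simpl; lra.
Qed.

Lemma exp_opp_lt_1 (v : R) : 0 < v -> exp (- v) < 1.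
Proof. intros hv; rewrite <- exp_0; apply exp_increasing; lra. Qed.

(** [(1 - v + v^2 / 2) (1 + v + v^2 / 2) = 1 + v^4 / 4]. *)
Lemma exp_opp_lt_quadratic (v : R) : 0 < v -> exp (- v) < 1 - v + v ^ 2 / 2.
Proof.
intros hv.
assert (h1 := exp_ge_quadratic v (Rlt_le _ _ hv)).
assert (h2 := exp_pos (- v)).
assert (h3 : exp (- v) * exp v = 1).
{ rewrite <- exp_plus, <- exp_0; f_equal; ring. }
assert (h4 : exp (- v) * (1 + v + v ^ 2 / 2) <= 1).
{ rewrite <- h3; apply Rmult_le_compat_l; lra. }
assert (h5 : 0 < v ^ 4) by (apply pow_lt, hv).
apply (Rmult_lt_reg_r (1 + v + v ^ 2 / 2)); [nra |].
replace ((1 - v + v ^ 2 / 2) * (1 + v + v ^ 2 / 2)) with (1 + v ^ 4 / 4) by field.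
lra.
Qed.

(** The function [e^(-s) (s^2 + 2 s + 2)] decreases for [s >= 0]: with
    [d = v - s], one has [e^d >= 1 + d + d^2 / 2]. *)
Lemma exp_opp_quadratic_decr (s v : R) :
  0 <= s <= v ->
  exp (- v) * (v ^ 2 + 2 * v + 2) <= exp (- s) * (s ^ 2 + 2 * s + 2).
Proof.
intros hs.
replace (exp (- s)) with (exp (- v) * exp (v - s))
  by (rewrite <- exp_plus; f_equal; ring).
rewrite Rmult_assoc; apply Rmult_le_compat_l; [apply Rlt_le, exp_pos |].
assert (hd : 0 <= v - s) by lra.
assert (h := exp_ge_quadratic (v - s) hd).
apply Rle_trans with ((1 + (v - s) + (v - s) ^ 2 / 2) * (s ^ 2 + 2 * s + 2)).
2: { apply Rmult_le_compat_r; [nra | exact h]. }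
apply Rminus_le_0.
replace ((1 + (v - s) + (v - s) ^ 2 / 2) * (s ^ 2 + 2 * s + 2)
         - (v ^ 2 + 2 * v + 2))
  with ((v - s) * s ^ 2 + (v - s) ^ 2 * s + (v - s) ^ 2 * s ^ 2 / 2) by field.
assert (0 <= s ^ 2) by nra.
assert (0 <= (v - s) ^ 2) by nra.
assert (0 <= s) by lra.
generalize (Rmult_le_pos (v - s) (s ^ 2)) (Rmult_le_pos ((v - s) ^ 2) s)
  (Rmult_le_pos ((v - s) ^ 2) (s ^ 2)); lra.
Qed.

Lemma is_interval_unit : is_interval (fun x => 0 < x <= 1).
Proof. intros x y z; lra. Qed.

Lemma is_interval_ge_1 : is_interval (fun x => 1 <= x).
Proof. intros x y z; lra. Qed.

(** With [s = v x] and [w = e^(-v)], the second derivative is a positive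
    multiple of [e^(-s) (s^2 + 2 s + 2) - 2 w (2 - w)].  As [s <= v], this is
    at least [w (v^2 + 2 v - 2 + 2 w)], which is positive since
    [w >= 1 - v]. *)
Lemma psi_div_strictly_convex (v : R) :
  0 < v -> strictly_convex_on (fun x => 0 < x <= 1) (fun x => psi v x / x).
Proof.
intros hv.
assert (hw1 := exp_opp_lt_1 v hv).
assert (hw0 := exp_pos (- v)).
apply strictly_convex_on_derive2 with
  (f' := fun x => (- v * exp (- (v * x)) / (1 - exp (- v)) + exp (- v)) / x
                  - psi v x / x ^ 2)
  (f'' := fun x => (exp (- (v * x)) * ((v * x) ^ 2 + 2 * (v * x) + 2)
                    - 2 * exp (- v) * (2 - exp (- v)))
                   / ((1 - exp (- v)) * x ^ 3)).
- exact is_interval_unit.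
- intros x hx; unfold psi; auto_derive; [lra |].
  field; lra.
- intros x hx; unfold psi; auto_derive.
  + repeat split; try lra; apply Rgt_not_eq; nra.
  + field; lra.
- intros x hx.
  apply Rdiv_lt_0_compat.
  2: { apply Rmult_lt_0_compat; [lra | apply pow_lt; lra]. }
  assert (h1 : 0 <= v * x <= v) by nra.
  assert (h2 := exp_opp_quadratic_decr _ _ h1).
  assert (h3 := exp_ineq1_le (- v)).
  assert (h4 : 0 < exp (- v) * (v ^ 2 + 2 * v + 2 - 2 * (2 - exp (- v)))).
  { apply Rmult_lt_0_compat; [exact hw0 | nra]. }
  lra.
Qed.

(** With [w = e^(-v)], the second derivative is a positive multiple of
    [2 w (1 - w) - e^(-v x) (2 v - x v^2)].  For [x >= 1] the subtracted
    product is at most [w (2 v - v^2)] unless it is negative, and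
    [2 v - v^2 < 2 (1 - w)]. *)
Lemma mul_psi_strictly_convex (v : R) :
  0 < v -> strictly_convex_on (fun x => 1 <= x) (fun x => x * psi v x).
Proof.
intros hv.
assert (hw1 := exp_opp_lt_1 v hv).
assert (hw0 := exp_pos (- v)).
apply strictly_convex_on_derive2 with
  (f' := fun x => psi v x
                  + x * (- v * exp (- (v * x)) / (1 - exp (- v)) + exp (- v)))
  (f'' := fun x => (2 * exp (- v) * (1 - exp (- v))
                    - exp (- (v * x)) * (2 * v - x * v ^ 2))
                   / (1 - exp (- v))).
- exact is_interval_ge_1.
- intros x hx; unfold psi; auto_derive; [lra |].
  field; lra.
- intros x hx; unfold psi; auto_derive; [lra |].
  field; lra.
- intros x hx.
  apply Rdiv_lt_0_compat; [| lra].
  assert (h1 := exp_opp_lt_quadratic v hv).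
  assert (h2 : 0 < exp (- v) * (2 * (1 - exp (- v)) - (2 * v - v ^ 2))).
  { apply Rmult_lt_0_compat; [exact hw0 | nra]. }
  assert (hE0 := exp_pos (- (v * x))).
  assert (hE : exp (- (v * x)) <= exp (- v)).
  { destruct hx as [hx | <-].
    - left; apply exp_increasing; nra.
    - rewrite Rmult_1_r; right; reflexivity. }
  assert (hc : 2 * v - x * v ^ 2 <= 2 * v - v ^ 2) by nra.
  destruct (Rle_dec 0 (2 * v - x * v ^ 2)) as [h | h].
  + assert (h3 : exp (- (v * x)) * (2 * v - x * v ^ 2)
                 <= exp (- v) * (2 * v - v ^ 2)).
    { apply Rmult_le_compat; lra. }
    lra.
  + assert (h3 : 0 < exp (- (v * x)) * (x * v ^ 2 - 2 * v)).
    { apply Rmult_lt_0_compat; lra. }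
    assert (h4 : 0 < exp (- v) * (1 - exp (- v))).
    { apply Rmult_lt_0_compat; lra. }
    lra.
Qed.

(** * The theorem *)

Lemma ln_Rpower (g p : R) : ln (Rpower g p) = p * ln g.
Proof. apply ln_exp. Qed.

Lemma index_mul_opp_ln_pos (q : R) (k : nat) :
  0 < q < 1 -> 0 < INR (S k) * - ln q.
Proof.
intros hq; apply Rmult_lt_0_compat; [apply lt_0_INR; lia |].
assert (ln q < 0) by (rewrite <- ln_1; apply ln_increasing; lra).
lra.
Qed.

Theorem theorem6 (q : R) (hq : 0 < q < 1) :
  strictly_log_convex_on (fun x => 0 < x <= 1)
    (fun x => Rpower (Gamma_q q x) (1 / x))
  /\
  strictly_log_convex_on (fun x => 1 <= x)
    (fun x => Rpower (Gamma_q q x) x).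
Proof.
split; (split; [intros; apply exp_pos |]).
- apply strictly_convex_on_series with
    (u := fun k x => / INR (S k) * (psi (INR (S k) * - ln q) x / x)).
  + exact is_interval_unit.
  + intros x hx; rewrite ln_Rpower.
    apply (is_series_ext_R (fun k =>
      1 / x * (/ INR (S k) * psi (INR (S k) * - ln q) x))).
    { intros k; unfold Rdiv; ring. }
    apply (is_series_scal_l (V := R_NormedModule) (1 / x)
      (fun k => / INR (S k) * psi (INR (S k) * - ln q) x)).
    apply is_series_ln_Gamma_q; lra.
  + intros k; apply strictly_convex_on_scal.
    * apply Rinv_0_lt_compat, lt_0_INR; lia.
    * apply psi_div_strictly_convex, index_mul_opp_ln_pos, hq.
- apply strictly_convex_on_series with
    (u := fun k x => / INR (S k) * (x * psi (INR (S k) * - ln q) x)).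
  + exact is_interval_ge_1.
  + intros x hx; rewrite ln_Rpower.
    apply (is_series_ext_R (fun k =>
      x * (/ INR (S k) * psi (INR (S k) * - ln q) x))).
    { intros k; ring. }
    apply (is_series_scal_l (V := R_NormedModule) x
      (fun k => / INR (S k) * psi (INR (S k) * - ln q) x)).
    apply is_series_ln_Gamma_q; lra.
  + intros k; apply strictly_convex_on_scal.
    * apply Rinv_0_lt_compat, lt_0_INR; lia.
    * apply mul_psi_strictly_convex, index_mul_opp_ln_pos, hq.
Qed.
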